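(* Let $$x_1=\tfrac{8+\sqrt{19}}{15},\quad x_2=\tfrac{7-\sqrt{19}}{15},\quad x_3=\tfrac{7+\sqrt{19}}{15},\quad x_4=\tfrac{8-\sqrt{19}}{15},\quad x_5=\tfrac35,\quad x_6=\tfrac{-1+\sqrt{19}}{15},\quad x_7=\tfrac{1+\sqrt{19}}{15}.$$ Then the following statements hold. (i) Every rectangle $R'$ with side lengths $a'$ and $b'$ satisfying $\frac{b'}{a'}\neq 7x_ix_j$ for every $i\neq j$ (with $i,j\in\{1,\dots,7\}$) admits a perfect Mondrian partition into $k=7$ rectangles. (ii) For every integer $k\ge 8$, every square $S$ admits a perfect Mondrian partition into $k$ rectangles.
   Context: All rectangles have real side lengths. Two rectangles are congruent, written $R_1\cong R_2$, if the lengths of their sides (not necessarily in the same order) are equal. A $k$-partition ($k\ge 2$) of a rectangle $R$ is a tiling of $R$ by $k$ rectangles $R_1,\dots,R_k$. A partition $\{R_1,\dots,R_k\}$ of $R$ is a Mondrian partition if $R_i\not\cong R_j$ for all $i\ne j$. A Mondrian partition is perfect if $\mathrm{area}(R_i)=\frac1k\,\mathrm{area}(R)$ for every $i$. Squares are special cases of rectangles. The numbers $x_1,\dots,x_7$ are the horizontal side lengths of the rectangles $R_1,\dots,R_7$ of a particular perfect Mondrian $7$-partition of the unit square, whose vertical side lengths are $y_i=\frac{1}{7x_i}$. *)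

(* Defs.v *)
From mathcomp Require Import all_boot all_order all_algebra reals.

Set Implicit Arguments.
Unset Strict Implicit.
Unset Printing Implicit Defensive.

Import Order.TTheory GRing.Theory Num.Theory.
Local Open Scope ring_scope.

(* A nondegenerate rectangle of the plane, in arbitrary position: one vertex,  *)
(* the unit vector [dir] pointing along the side of length [width], and the    *)
(* two side lengths.  The side of length [height] points along [dir] rotated   *)
(* by a quarter turn counterclockwise.                                         *)
Record rectangle (R : realType) := Rectangle {
  vertex : R * R;
  dir : R * R;
  width : R;
  height : R;
  dir_unit : dir.1 ^+ 2 + dir.2 ^+ 2 = 1;
  width_gt0 : 0 < width;
  height_gt0 : 0 < height }.

(* Coordinates of [p] in the orthonormal frame attached to [Q]. *)
Definition coord1 (R : realType) (Q : rectangle R) (p : R * R) : R :=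
  (p.1 - (vertex Q).1) * (dir Q).1 + (p.2 - (vertex Q).2) * (dir Q).2.

Definition coord2 (R : realType) (Q : rectangle R) (p : R * R) : R :=
  (p.2 - (vertex Q).2) * (dir Q).1 - (p.1 - (vertex Q).1) * (dir Q).2.

Definition in_rect (R : realType) (Q : rectangle R) (p : R * R) : bool :=
  (0 <= coord1 Q p <= width Q) && (0 <= coord2 Q p <= height Q).

Definition in_interior (R : realType) (Q : rectangle R) (p : R * R) : bool :=
  (0 < coord1 Q p < width Q) && (0 < coord2 Q p < height Q).

Definition area (R : realType) (Q : rectangle R) : R := width Q * height Q.

Definition has_sides (R : realType) (Q : rectangle R) (a b : R) : Prop :=
  (width Q = a /\ height Q = b) \/ (width Q = b /\ height Q = a).

Definition is_square (R : realType) (Q : rectangle R) : Prop :=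
  width Q = height Q.

Definition congruent (R : realType) (Q1 Q2 : rectangle R) : Prop :=
  has_sides Q1 (width Q2) (height Q2).

Definition is_partition (R : realType) (k : nat) (Q : rectangle R)
    (P : 'I_k -> rectangle R) : Prop :=
  [/\ (2 <= k)%N,
      forall p : R * R, in_rect Q p <-> exists i : 'I_k, in_rect (P i) p &
      forall (i j : 'I_k) (p : R * R),
        i != j -> ~ (in_interior (P i) p /\ in_interior (P j) p)].

Definition is_Mondrian (R : realType) (k : nat) (Q : rectangle R)
    (P : 'I_k -> rectangle R) : Prop :=
  is_partition Q P /\ forall i j : 'I_k, i != j -> ~ congruent (P i) (P j).

Definition is_perfect_Mondrian (R : realType) (k : nat) (Q : rectangle R)
    (P : 'I_k -> rectangle R) : Prop :=
  is_Mondrian Q P /\ forall i : 'I_k, area (P i) = k%:R^-1 * area Q.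

(* Indices are shifted by one: [xs i] is x_(i+1). *)
Definition xs (R : realType) (i : 'I_7) : R :=
  let r := Num.sqrt (19 : R) in
  nth 0 [:: (8 + r) / 15; (7 - r) / 15; (7 + r) / 15; (8 - r) / 15;
            3 / 5; (-1 + r) / 15; (1 + r) / 15] i.

(* Main.v *)
Require Import Defs.
From mathcomp Require Import all_boot all_order all_algebra reals.
From mathcomp Require Import zify ring lra.

Set Implicit Arguments.
Unset Strict Implicit.
Unset Printing Implicit Defensive.

Import Order.TTheory GRing.Theory Num.Theory.
Local Open Scope ring_scope.

(** A perfect Mondrian partition of the unit square into seven rectangles is
    given explicitly; its tiles have horizontal sides [xs R i] and vertical sides
    [1 / (7 * xs R i)].  Stretching it affinely onto a rectangle with sides [W]
    and [H] keeps all areas equal.  Since the [xs R i] are pairwise distinct, two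
    stretched tiles [i] and [j] can only become congruent after a quarter turn,
    that is if [W * xs R i = H / (7 * xs R j)], which is the excluded ratio
    [H / W = 7 * xs R i * xs R j]: see [seven_boxes_perfect].

    For [k >= 8] tiles, strips of area [1 / k] of the total are cut off a square
    one after the other, each along the shorter side of the rectangle that is
    left, until seven tiles remain to be placed ([spiral_tiling]).  A rectangle
    with sides [b <= a] which must receive [n] tiles satisfies
    [a * (n - 1) < b * n] throughout, so that the strip of length [b] leaves a
    rectangle with longer side [b] and shorter side [a * (n - 1) / n < b].  All
    later tiles then have sides smaller than [b], hence none of them is congruent
    to the strip.

    The last rectangle, with sides [b < a], receives the stretched seven tiles.
    Its ratio [b / a] is a rational [q / p], and following the parities of [p] and
    [q] along the strips shows that [q] is odd and [p] even.  Such a ratio is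
    never [7 * xs R i * xs R j] ([xs_ratio_neq]): each [15 * xs R i] is in
    [Z + Z * sqrt 19], so, [sqrt 19] being irrational, an equality would give
    [225 * q = 7 * p * A] for some integer [A], against the parities.

    All tilings are built from boxes with sides parallel to the axes;
    [perfect_tiling_Mondrian] places them in a rectangle in arbitrary position by
    means of its orthonormal frame. *)

(** * Boxes and perfect tilings *)

(** The box with lower left corner [(xmin, ymin)] and sides [xlen], [ylen]
    parallel to the axes.  Positivity of the sides is not part of the type; it is
    required in [perfect_tiling]. *)

Record box (R : realFieldType) := Box {
  xmin : R; ymin : R; xlen : R; ylen : R }.

(** The closed box. *)
Definition in_box (R : realFieldType) (x y : R) (b : box R) : bool :=
  (xmin b <= x <= xmin b + xlen b) && (ymin b <= y <= ymin b + ylen b).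

(** One of the lines parallel to the axes separates the two boxes; this is a
    decidable form of having disjoint interiors. *)
Definition separated (R : realFieldType) (b c : box R) : bool :=
  [|| xmin b + xlen b <= xmin c, xmin c + xlen c <= xmin b,
      ymin b + ylen b <= ymin c | ymin c + ylen c <= ymin b].

Definition noncongruent (R : realFieldType) (b c : box R) : bool :=
  ~~ ((xlen b == xlen c) && (ylen b == ylen c)
      || (xlen b == ylen c) && (ylen b == xlen c)).

(** [s] lists the tiles of a perfect Mondrian partition of the rectangle
    [[0, W] x [0, H]] into [size s] boxes. *)
Definition perfect_tiling (R : realFieldType) (W H : R) (s : seq (box R)) :
    Prop :=
  [/\ forall x y, has (in_box x y) s = (0 <= x <= W) && (0 <= y <= H),
      all (fun b => [&& 0 < xlen b, 0 < ylen b &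
                        xlen b * ylen b * (size s)%:R == W * H]) s,
      pairwise (@separated R) s &
      pairwise (@noncongruent R) s].

(** The reflection of a box in the diagonal [x = y]. *)
Definition transpose (R : realFieldType) (b : box R) : box R :=
  Box (ymin b) (xmin b) (ylen b) (xlen b).

Lemma perfect_tiling_transpose (R : realFieldType) (W H : R) s :
  perfect_tiling W H s -> perfect_tiling H W (map (@transpose R) s).
Proof.
case=> cov pos sep nc; split.
- move=> x y; rewrite has_map andbC -cov; apply: eq_has => b.
  by rewrite /in_box /= andbC.
- rewrite all_map size_map; apply: sub_all pos => b /= /and3P[-> -> /eqP].
  by move=> e; rewrite (mulrC (ylen b)) e mulrC eqxx.
- rewrite pairwise_map; apply: sub_pairwise sep => b c.
  by rewrite /separated /= => /or4P[] ->; rewrite ?orbT.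
- rewrite pairwise_map; apply: sub_pairwise nc => b c.
  by rewrite /noncongruent /= andbC [X in _ || X]andbC.
Qed.

(** Adding on top of a perfect tiling one more box of the common area, as wide as
    the tiled rectangle.  If the sides of the old tiles are all smaller than the
    width [W], none of them is congruent to the new box. *)
Lemma perfect_tiling_strip (R : realFieldType) (W H : R) (s : seq (box R)) :
  0 < W -> 0 < H -> (0 < size s)%N -> perfect_tiling W H s ->
  all (fun b => (xlen b < W) && (ylen b < W)) s ->
  perfect_tiling W (H + H / (size s)%:R)
    (Box 0 H W (H / (size s)%:R) :: s).
Proof.
move=> W0 H0 s0 [cov pos sep nc] small.
have n0 : 0 < (size s)%:R :> R by rewrite ltr0n.
have h0 : 0 < H / (size s)%:R by rewrite divr_gt0.
split.
- move=> x y /=; rewrite cov /in_box /= add0r.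
  set h := H / _ in h0 *.
  apply/idP/idP.
    by case/orP => /andP[/andP[? ?] /andP[? ?]]; apply/andP; split;
      apply/andP; split => //; lra.
  case/andP => -> /andP[y0 yH] /=.
  by case: (lerP H y) => Hy; rewrite ?y0 ?yH //= ltW.
- apply/andP; split.
    rewrite /= W0 h0 /= -natr1; apply/eqP; field; by rewrite gt_eqF.
  apply: sub_all pos => b /and3P[-> -> /eqP e] /=.
  rewrite -natr1 mulrDr e mulr1.
  have -> : xlen b * ylen b = W * H / (size s)%:R by rewrite -e mulfK ?gt_eqF.
  by apply/eqP; ring.
- rewrite /= sep andbT.
  pose b0 : box R := Box 0 H W (H / (size s)%:R).
  apply/(all_nthP b0) => i lti.
  have /and3P[w0 l0 _] := all_nthP b0 pos i lti.
  set b := nth b0 s i in w0 l0 *.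
  (* The top left corner of a tile lies in the tiled rectangle. *)
  have : has (in_box (xmin b) (ymin b + ylen b)) s.
    apply/(has_nthP b0); exists i => //; rewrite -/b /in_box.
    by rewrite !lexx !lerDl !ltW.
  by rewrite cov => /andP[_ /andP[_ bH]]; rewrite /separated /= bH !orbT.
- rewrite /= nc andbT; apply: sub_all small => b /andP[bx by_].
  by rewrite /noncongruent /= !(gt_eqF bx) !(gt_eqF by_).
Qed.

(** * From boxes to rectangles in arbitrary position *)

(** The rectangle which is the box [b] in the orthonormal frame of [Q]. *)
Definition subrectangle (R : realType) (Q : rectangle R) (b : box R)
    (w0 : 0 < xlen b) (h0 : 0 < ylen b) : rectangle R :=
  Rectangle
    ((vertex Q).1 + xmin b * (dir Q).1 - ymin b * (dir Q).2,
     (vertex Q).2 + xmin b * (dir Q).2 + ymin b * (dir Q).1)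
    (dir_unit Q) w0 h0.

Lemma coord1_subrectangle (R : realType) (Q : rectangle R) (b : box R) w0 h0 p :
  coord1 (@subrectangle R Q b w0 h0) p = coord1 Q p - xmin b.
Proof.
rewrite /coord1 /=; have := dir_unit Q; case: (dir Q) => [c d] /= e.
transitivity ((p.1 - (vertex Q).1) * c + (p.2 - (vertex Q).2) * d
              - xmin b * (c ^+ 2 + d ^+ 2)); first by ring.
by rewrite e mulr1.
Qed.

Lemma coord2_subrectangle (R : realType) (Q : rectangle R) (b : box R) w0 h0 p :
  coord2 (@subrectangle R Q b w0 h0) p = coord2 Q p - ymin b.
Proof.
rewrite /coord2 /=; have := dir_unit Q; case: (dir Q) => [c d] /= e.
transitivity ((p.2 - (vertex Q).2) * c - (p.1 - (vertex Q).1) * d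
              - ymin b * (c ^+ 2 + d ^+ 2)); first by ring.
by rewrite e mulr1.
Qed.

Lemma in_rect_subrectangle (R : realType) (Q : rectangle R) (b : box R) w0 h0 p :
  in_rect (@subrectangle R Q b w0 h0) p = in_box (coord1 Q p) (coord2 Q p) b.
Proof.
rewrite /in_rect coord1_subrectangle coord2_subrectangle /in_box /=.
by rewrite !subr_ge0 !lerBlDl.
Qed.

Lemma separated_interior (R : realType) (Q : rectangle R) (b c : box R)
    wb hb wc hc p :
  separated b c ->
  ~ (in_interior (@subrectangle R Q b wb hb) p /\
     in_interior (@subrectangle R Q c wc hc) p).
Proof.
rewrite /in_interior !coord1_subrectangle !coord2_subrectangle /=.
move=> sep [/andP[/andP[? ?] /andP[? ?]] /andP[/andP[? ?] /andP[? ?]]].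
by case/or4P: sep => ?; lra.
Qed.

Lemma separated_sym (R : realFieldType) : symmetric (@separated R).
Proof.
by move=> b c; rewrite /separated orbCA !orbA -orbA [X in _ || X]orbC orbA.
Qed.

Lemma noncongruent_sym (R : realFieldType) : symmetric (@noncongruent R).
Proof.
move=> b c; rewrite /noncongruent (eq_sym (xlen c)) (eq_sym (ylen c)).
by rewrite (eq_sym (xlen c)) (eq_sym (ylen c)) (andbC (ylen b == xlen c)).
Qed.

Lemma pairwise_nth_neq (T : Type) (r : rel T) (x0 : T) (s : seq T) (i j : nat) :
  symmetric r -> pairwise r s -> (i < size s)%N -> (j < size s)%N -> i != j ->
  r (nth x0 s i) (nth x0 s j).
Proof.
move=> rsym /(pairwiseP x0) h ilt jlt.
rewrite neq_ltn => /orP[ij|ji]; first exact: h.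
by rewrite rsym; apply: h.
Qed.

Lemma perfect_tiling_Mondrian (R : realType) (Q : rectangle R)
    (s : seq (box R)) (k : nat) :
  size s = k -> (2 <= k)%N -> perfect_tiling (width Q) (height Q) s ->
  exists P : 'I_k -> rectangle R, is_perfect_Mondrian Q P.
Proof.
move=> <- k2 [cov pos sep nc].
pose b0 : box R := Box 0 0 0 0.
have w0 (i : 'I_(size s)) : 0 < xlen (nth b0 s i).
  by case/and3P: (all_nthP b0 pos i (ltn_ord i)).
have h0 (i : 'I_(size s)) : 0 < ylen (nth b0 s i).
  by case/and3P: (all_nthP b0 pos i (ltn_ord i)).
exists (fun i => subrectangle Q (w0 i) (h0 i)); split; first split; first split.
- by [].
- move=> p; have -> : in_rect Q p = has (in_box (coord1 Q p) (coord2 Q p)) s.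
    by rewrite cov.
  split.
    case/(has_nthP b0) => i ilt ib; exists (Ordinal ilt).
    by rewrite in_rect_subrectangle.
  case=> i; rewrite in_rect_subrectangle => ib.
  by apply/(has_nthP b0); exists i.
- move=> i j p ij; apply: separated_interior.
  by apply: pairwise_nth_neq => //; apply: separated_sym.
- move=> i j ij.
  have : noncongruent (nth b0 s i) (nth b0 s j).
    by apply: pairwise_nth_neq => //; apply: noncongruent_sym.
  rewrite /congruent /has_sides /noncongruent /= negb_or => /andP[n1 n2].
  by case=> -[e1 e2]; [case/negP: n1|case/negP: n2]; rewrite e1 e2 !eqxx.
- move=> i; case/and3P: (all_nthP b0 pos i (ltn_ord i)) => _ _ /eqP e.
  rewrite /area /= -e [RHS]mulrC mulfK // pnatr_eq0; by case: (size s) k2.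
Qed.

(** * The arithmetic of the seven side lengths *)

Lemma sqr_eq_19sqr_nat (m n : nat) : (m ^ 2 = 19 * n ^ 2 -> m = 0)%N.
Proof.
move=> e; case: (posnP m) => // m0.
have n0 : (0 < n)%N.
  by case: n e => //; rewrite muln0 => /eqP; rewrite expn_eq0 andbT gtn_eqF.
have := congr1 (logn 19) e.
rewrite lognM ?expn_gt0 ?n0 // !lognX (pfactorK 1) //; lia.
Qed.

Lemma sqr_eq_19sqr (R : realType) (X Y : int) :
  (X%:~R = Y%:~R * Num.sqrt 19 :> R) -> X = 0.
Proof.
move=> e.
have e2 : X ^+ 2 = 19 * Y ^+ 2.
  apply: (@intr_inj R).
  by rewrite [RHS]intrM !rmorphXn /= e exprMn sqr_sqrtr ?ler0n // mulrC.
apply/eqP; rewrite -absz_eq0; apply/eqP.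
apply: (@sqr_eq_19sqr_nat _ `|Y|).
by rewrite -!abszX e2 abszM.
Qed.

(** The seven lengths lie in [(Z + Z * sqrt 19) / 15]. *)
Lemma xs_quadratic (R : realType) (i : 'I_7) :
  exists u v : int, 15 * xs R i = u%:~R + v%:~R * Num.sqrt 19.
Proof.
rewrite /xs; set r := Num.sqrt 19.
by case: i => [[|[|[|[|[|[|[|i]]]]]]] lti] //=;
  [exists 8, 1|exists 7, (-1)|exists 7, 1|exists 8, (-1)|exists 9, 0
  |exists (-1), 1|exists 1, 1]; field.
Qed.

(** The case [i = j] and the irrational products are covered as well: only the
    parities of the numerator and of the denominator matter. *)
Lemma xs_ratio_neq (R : realType) (p q : nat) (i j : 'I_7) :
  odd q -> ~~ odd p -> q%:R <> p%:R * (7 * xs R i * xs R j).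
Proof.
move=> oq op e.
have [u [v eu]] := xs_quadratic R i; have [u' [v' ev]] := xs_quadratic R j.
set r := Num.sqrt 19 in eu ev.
have r2 : r * r = 19 by rewrite -expr2 sqr_sqrtr ?ler0n.
have [A eA] : exists A : int, A%:~R = u%:~R * u'%:~R + 19 * (v%:~R * v'%:~R) :> R.
  by exists (u * u' + 19%:Z * (v * v')); rewrite intrD !intrM.
have [B eB] : exists B : int, B%:~R = u%:~R * v'%:~R + v%:~R * u'%:~R :> R.
  by exists (u * v' + v * u'); rewrite intrD !intrM.
(* Separating the rational part gives X = Y * sqrt 19 with X, Y integers. *)
have e2 : (225%:Z * q%:Z - 7%:Z * p%:Z * A)%:~R = (7%:Z * p%:Z * B)%:~R * r.
  rewrite intrB !intrM eA eB -!pmulrn e.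
  transitivity (p%:R * (7 * (15 * xs R i) * (15 * xs R j))
    - 7 * p%:R * (u%:~R * u'%:~R + 19 * (v%:~R * v'%:~R))); first by ring.
  by rewrite eu ev -r2; ring.
have {e2} := sqr_eq_19sqr e2 => e2.
by have [m [m' [e3 e4]]] : exists m m', p = m.*2 /\ q = m'.*2.+1;
  [exists p./2, q./2; lia | lia].
Qed.

Lemma sqrt19_bounds (R : realType) :
  4 + 1 / 3 < Num.sqrt (19 : R) < 4 + 3 / 8.
Proof.
have r2 : Num.sqrt (19 : R) ^+ 2 = 19 by rewrite sqr_sqrtr ?ler0n.
have r0 : 0 <= Num.sqrt (19 : R) by apply: sqrtr_ge0.
by apply/andP; split; rewrite -(ltr_pXn2r (n := 2)) ?nnegrE ?r2 //; lra.
Qed.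

Lemma xs_inj (R : realType) : injective (@xs R).
Proof.
have := sqrt19_bounds R; set r := Num.sqrt _ => rb.
move=> [i ilt] [j jlt] e; apply: val_inj => /=; move: e; rewrite /xs -/r /=.
by move: i j ilt jlt =>
  [|[|[|[|[|[|[|i]]]]]]] [|[|[|[|[|[|[|j]]]]]]] //= _ _ e; exfalso; lra.
Qed.

Lemma xs_bounds (R : realType) (i : 'I_7) : 1 / 7 < xs R i < 1.
Proof.
have := sqrt19_bounds R; rewrite /xs; set r := Num.sqrt _ => rb.
by case: i => [[|[|[|[|[|[|[|i]]]]]]] lti] //=; lra.
Qed.

(** * The seven tiles *)

(** The seven tiles stretched to [[0, W] x [0, H]], listed in the order of
    [xs].  The first and second lie in the upper left and upper right corners, the
    third and fourth in the lower right and lower left ones; the fifth is the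
    remaining part of the left side, and the last two fill the middle, the sixth
    to the right of the seventh.  The vertical sides are those of
    [H / (7 * xs R i)] with rationalized denominators, so that all positions are
    affine in [sqrt 19]. *)
Definition seven_boxes (R : realType) (W H : R) : seq (box R) :=
  let r := Num.sqrt 19 in
  [:: Box 0 (H * ((13 + r) / 21)) (W * ((8 + r) / 15)) (H * ((8 - r) / 21));
      Box (W * ((8 + r) / 15)) (H * ((7 - r) / 14))
          (W * ((7 - r) / 15)) (H * ((7 + r) / 14));
      Box (W * ((8 - r) / 15)) 0 (W * ((7 + r) / 15)) (H * ((7 - r) / 14));
      Box 0 0 (W * ((8 - r) / 15)) (H * ((8 + r) / 21));
      Box 0 (H * ((8 + r) / 21)) (W * (3 / 5)) (H * (5 / 21));
      Box (W * (3 / 5)) (H * ((7 - r) / 14))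
          (W * ((-1 + r) / 15)) (H * (5 * (1 + r) / 42));
      Box (W * ((8 - r) / 15)) (H * ((7 - r) / 14))
          (W * ((1 + r) / 15)) (H * (5 * (-1 + r) / 42))].

Lemma seven_boxes_sides (R : realType) (W H : R) (b0 : box R) (i : 'I_7) :
  let b := nth b0 (seven_boxes W H) i in
  xlen b = W * xs R i /\ ylen b = H / (7 * xs R i).
Proof.
have := sqrt19_bounds R; rewrite /xs /seven_boxes.
have r2 : Num.sqrt (19 : R) ^+ 2 = 19 by rewrite sqr_sqrtr ?ler0n.
set r := Num.sqrt _ in r2 * => rb.
have key (x y : R) : x != 0 -> 7 * x * y = 1 -> H * y = H / (7 * x).
  move=> x0 e; congr (_ * _); apply: (mulfI (x := 7 * x)).
    by rewrite mulf_neq0 // pnatr_eq0.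
  by rewrite e divff // mulf_neq0 // pnatr_eq0.
by case: i => [[|[|[|[|[|[|[|i]]]]]]] lti] //=; split => //;
  apply: key; try (by rewrite gt_eqF //; lra); lra.
Qed.

Lemma seven_boxes_perfect (R : realType) (W H : R) :
  0 < W -> 0 < H ->
  (forall i j : 'I_7, i != j -> H <> W * (7 * xs R i * xs R j)) ->
  perfect_tiling W H (seven_boxes W H).
Proof.
move=> W0 H0 ratio; pose b0 : box R := Box 0 0 0 0.
have side i := seven_boxes_sides W H b0 i.
have x0 i : 0 < xs R i by have := xs_bounds R i; lra.
split.
- move=> x y; rewrite /seven_boxes; have := sqrt19_bounds R.
  set r := Num.sqrt _ => rb.
  (* In coordinates relative to W and H, all inequalities become affine. *)
  have [x' ->] : exists x', x = W * x'.
    by exists (x / W); rewrite mulrCA divff ?mulr1 // gt_eqF.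
  have [y' ->] : exists y', y = H * y'.
    by exists (y / H); rewrite mulrCA divff ?mulr1 // gt_eqF.
  rewrite /= /in_box /= -!mulrDr !add0r !(ler_pM2l W0) !(ler_pM2l H0).
  rewrite !(pmulr_rge0 _ W0) !(pmulr_rge0 _ H0).
  rewrite !(ger_pMr _ W0) !(ger_pMr _ H0).
  apply/idP/idP.
    rewrite orbF.
    by do 6?[case/orP] => /andP[/andP[? ?] /andP[? ?]];
      apply/andP; split; apply/andP; split; lra.
  case/andP => /andP[? ?] /andP[? ?].
  (* Locating a point: heights up to (7 - r) / 14 belong to the two bottom tiles. *)
  have /orP[yl|yl] := le_total y' ((7 - r) / 14);
    have /orP[xl|xl] := le_total x' ((8 - r) / 15).
  - by do 3!(apply/orP; right); apply/orP; left; lra.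
  - by do 2!(apply/orP; right); apply/orP; left; lra.
  - have /orP[y4|y4] := le_total y' ((8 + r) / 21).
      by do 3!(apply/orP; right); apply/orP; left; lra.
    have /orP[y5|y5] := le_total y' ((13 + r) / 21).
      by do 4!(apply/orP; right); apply/orP; left; lra.
    by apply/orP; left; lra.
  - have /orP[x1|x1] := le_total ((8 + r) / 15) x'.
      by apply/orP; right; apply/orP; left; lra.
    have /orP[y5|y5] := le_total ((13 + r) / 21) y'.
      by apply/orP; left; lra.
    have /orP[x5|x5] := le_total (3 / 5) x'.
      by do 5!(apply/orP; right); apply/orP; left; lra.
    have /orP[y4|y4] := le_total ((8 + r) / 21) y'.
      by do 4!(apply/orP; right); apply/orP; left; lra.
    by do 6!(apply/orP; right); apply/orP; left; lra.
- apply/(all_nthP b0) => i ilt; have [/= e1 e2] := side (Ordinal ilt).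
  have xi := x0 (Ordinal ilt).
  rewrite e1 e2 !(mulr_gt0, divr_gt0, invr_gt0) //=.
  by apply/eqP; field; rewrite gt_eqF.
- rewrite /seven_boxes; have := sqrt19_bounds R; set r := Num.sqrt _ => rb.
  rewrite /= /separated /= -!mulrDr !add0r !(ler_pM2l W0) !(ler_pM2l H0) !andbT.
  do !(apply/andP; split); apply/or4P;
    first [apply: Or41; lra|apply: Or42; lra|apply: Or43; lra|apply: Or44; lra].
- apply/(pairwiseP b0) => i j ilt jlt ij.
  have [/= e1 e2] := side (Ordinal ilt); have [/= e3 e4] := side (Ordinal jlt).
  have ne : Ordinal ilt != Ordinal jlt by rewrite neq_ltn ij.
  rewrite /noncongruent e1 e2 e3 e4 negb_or; apply/andP; split; apply/negP.
    by case/andP => /eqP /(mulfI (lt0r_neq0 W0)) /xs_inj /eqP; rewrite (negPf ne).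
  (* Congruence after a quarter turn is the excluded ratio. *)
  case/andP => /eqP e _; apply: (ratio _ _ ne).
  have xj := x0 (Ordinal jlt).
  transitivity (W * xs R (Ordinal ilt) * (7 * xs R (Ordinal jlt))); last by ring.
  by rewrite e divfK // gt_eqF // mulr_gt0.
Qed.

(** * Cutting strips off a rectangle *)

(** A rectangle with sides [b <= a] and [b / a = q / p] is tiled by a spiral of
    strips around a copy of the seven tiles.  The bound [a * (n - 1) < b * n] makes
    the strip of length [b] leave a shorter side smaller than [b], and both it and
    the parity conditions pass to the rectangle left by the strip, whose ratio is
    [n * p / ((n + 1) * q)] if there are [n + 1] tiles.  The bound on the sides of
    the tiles is what makes the next strip outwards noncongruent to all of them;
    it fails for the first strip of a square, hence the hypothesis [b < a]. *)
Lemma spiral_tiling (R : realType) (n : nat) (a b : R) (p q : nat) :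
  (7 <= n)%N -> 0 < b -> b <= a -> a * n.-1%:R < b * n%:R ->
  a * q%:R = b * p%:R ->
  (odd n -> odd q) -> (~~ odd n -> odd p) -> (n = 7%N -> ~~ odd p) ->
  exists s : seq (box R), [/\ size s = n, perfect_tiling a b s &
    b < a -> all (fun c => (xlen c < a) && (ylen c < a)) s].
Proof.
move=> n7; rewrite -(subnK n7); move: (n - 7)%N => m {n n7}.
elim: m a b p q => [|m IH] a b p q b0 ba ab epq oq op np7.
  have a0 : 0 < a by apply: lt_le_trans ba.
  exists (seven_boxes a b); split => //.
    apply: seven_boxes_perfect => // i j _ e.
    apply: (@xs_ratio_neq R p q i j); [exact: oq|exact: np7|].
    by apply: (mulfI (lt0r_neq0 a0)); rewrite epq e; ring.
  move=> _; apply/(all_nthP (Box 0 0 0 0)) => i ilt.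
  have [/= -> ->] := seven_boxes_sides a b (Box 0 0 0 0) (Ordinal ilt).
  have /andP[x7 x1] := xs_bounds R (Ordinal ilt).
  have x71 : 1 < 7 * xs R (Ordinal ilt) by lra.
  rewrite gtr_pMr // x1 /=; apply: lt_le_trans ba.
  by rewrite ltr_pdivrMr ?ltr_pMr // (lt_trans ltr01).
move: oq op np7 ab; rewrite !addSn.
move En : (m + 7)%N IH => n IH; rewrite /= => oq op _ ab.
have n0 : (0 < n)%N by rewrite -En addn_gt0 orbT.
have N0 : 0 < n%:R :> R by rewrite ltr0n.
have N1 : 0 < n%:R + 1 :> R by rewrite addr_gt0.
have a0 : 0 < a by apply: lt_le_trans ba.
have e1 : n.+1%:R = n%:R + 1 :> R by rewrite natr1.
(* The strip of length b and area a * b / (n + 1) leaves sides b and a'. *)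
pose a' := a * n%:R / (n%:R + 1).
have ea : a' * (n%:R + 1) = a * n%:R by rewrite divfK // gt_eqF.
have a'0 : 0 < a' by rewrite divr_gt0 // mulr_gt0.
have a'b : a' < b by rewrite ltr_pdivrMr // -e1.
have [] := IH b a' (n.+1 * q)%N (n * p)%N a'0 (ltW a'b).
- have -> : n.-1%:R = n%:R - 1 :> R.
    by rewrite -[in RHS](prednK n0) -natr1 addrK.
  rewrite -(ltr_pM2r N1) mulrAC -[X in _ < X]mulrA (mulrC n%:R) mulrA ea.
  have Nm : 0 <= (n%:R + 1) * (n%:R - 1) :> R.
    by rewrite mulr_ge0 ?(ltW N1) // subr_ge0 ler1n.
  rewrite -mulrA; apply: le_lt_trans (ler_wpM2r Nm ba) _.
  rewrite -[X in _ < X]mulrA ltr_pM2l //.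
  have -> : (n%:R + 1) * (n%:R - 1) = n%:R * n%:R - 1 :> R by ring.
  by rewrite ltrBlDr ltrDl ltr01.
- by rewrite !natrM e1 [RHS]mulrA ea mulrCA -epq; ring.
- by move=> on; rewrite oddM on op //= on.
- by move=> on; rewrite oddM /= on oq.
- by move=> n7; rewrite oddM n7.
move=> s [sz til small]; have {}small := small a'b.
pose t := Box 0 a' b (a' / n%:R) :: s.
have aE : a' + a' / n%:R = a by rewrite /a'; field; rewrite !gt_eqF.
exists (map (@transpose R) t); split.
- by rewrite size_map /= sz.
- apply: perfect_tiling_transpose; rewrite /t -[in X in perfect_tiling b X]aE.
  by rewrite -sz; apply: perfect_tiling_strip; rewrite ?sz.
- move=> lt_ba; rewrite all_map /= lt_ba andbT; apply/andP; split.
    by rewrite -aE ltrDr.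
  apply: sub_all small => c /= /andP[cx cy].
  by rewrite !(lt_trans _ lt_ba).
Qed.

Theorem theorem5p1 (R : realType) :
  (forall (R' : rectangle R) (a' b' : R),
     has_sides R' a' b' ->
     (forall i j : 'I_7, i != j -> b' / a' <> 7 * xs R i * xs R j) ->
     exists P : 'I_7 -> rectangle R, is_perfect_Mondrian R' P)
  /\
  (forall k : nat, (8 <= k)%N ->
   forall S : rectangle R, is_square S ->
     exists P : 'I_k -> rectangle R, is_perfect_Mondrian S P).
Proof.
split=> [R' a' b' sides ratio|k k8 S sq].
  have ratioM (W H : R) : 0 < W -> H / W = b' / a' ->
      forall i j : 'I_7, i != j -> H <> W * (7 * xs R i * xs R j).
    move=> W0 e i j ij eH; apply: (ratio i j ij).
    by rewrite -e eH mulrC mulKf // gt_eqF.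
  have := width_gt0 R'; have := height_gt0 R'.
  case: sides => -[ew eh] h0 w0; rewrite ew eh in h0 w0.
    apply: (@perfect_tiling_Mondrian R R' (seven_boxes a' b')) => //.
    by rewrite ew eh; apply: seven_boxes_perfect => //; apply: ratioM.
  apply: (@perfect_tiling_Mondrian R R'
            (map (@transpose R) (seven_boxes a' b'))) => //.
  rewrite ew eh; apply: perfect_tiling_transpose.
  by apply: seven_boxes_perfect => //; apply: ratioM.
have w0 := width_gt0 S.
have [] := @spiral_tiling R k (width S) (width S) 1 1 (ltnW k8) w0 (lexx _).
- by rewrite ltr_pM2l // ltr_nat prednK // (leq_trans _ k8).
- by [].
- by [].
- by [].
- by move=> k7; rewrite k7 in k8.
move=> s [sz til _]; apply: (@perfect_tiling_Mondrian R S s k) => //.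
  exact: leq_trans k8.
by rewrite -sq.
Qed.
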